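(* Let $p$ be a positive even integer. For any Borel probability measure $\mu$ on $S^{d-1}$, $$\int_{S^{d-1}}\int_{S^{d-1}}|\langle x,y\rangle|^p\,d\mu(x)\,d\mu(y)\ \ge\ \frac{1\cdot3\cdot5\cdots(p-1)}{d(d+2)\cdots(d+p-2)},$$ and equality holds if and only if $\mu$ is a tight probabilistic $p$-frame for $\mathbb{R}^d$.
   Context: $S^{d-1}$ is the unit sphere of $\mathbb{R}^d$. A Borel probability measure $\mu$ on $S^{d-1}$ is a tight probabilistic $p$-frame for $\mathbb{R}^d$ if there is a constant $A>0$ such that $\int_{S^{d-1}}|\langle x,y\rangle|^p\,d\mu(x)=A\|y\|^p$ for all $y\in\mathbb{R}^d$. The numerator is the product of the odd integers from $1$ to $p-1$ and the denominator is the product $\prod_{j=0}^{p/2-1}(d+2j)$. *)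

(* Defs.v *)
From HB Require Import structures.
From mathcomp Require Import all_boot all_order all_algebra.
From mathcomp Require Import all_classical all_reals all_analysis.

Set Implicit Arguments.
Unset Strict Implicit.
Unset Printing Implicit Defensive.

Import Order.TTheory GRing.Theory Num.Theory.
Import numFieldNormedType.Exports.

Local Open Scope classical_set_scope.
Local Open Scope ring_scope.

Section Defs.
Variable R : realType.

Definition dotp d (x y : 'rV[R]_d) : R := \sum_(i < d) x 0 i * y 0 i.

(* The library norm `|x| on 'rV[R]_d is the sup norm, hence this one. *)
Definition enorm d (x : 'rV[R]_d) : R := Num.sqrt (dotp x x).

Definition usphere d : set 'rV[R]_d := [set x | enorm x = 1].

Lemma delta_usphere n : usphere (delta_mx 0 0 : 'rV[R]_n.+1).
Proof.
rewrite /usphere /enorm /dotp /= big_ord_recl !mxE !eqxx mulr1 big1 ?addr0 ?sqrtr1 //.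
by move=> i _; rewrite !mxE /= mulr0.
Qed.

(* S^n inside R^(n+1), with the subspace topology that set_type carries.
   The dimension is a successor because a measurableType must be inhabited. *)
Definition sphere n : Type := set_type (@usphere n.+1).

HB.instance Definition _ n := Topological.on (sphere n).
HB.instance Definition _ n := isPointed.Build (sphere n)
  (exist _ (delta_mx 0 0 : 'rV[R]_n.+1) (mem_set (@delta_usphere n))).

(* S^n with its Borel sigma-algebra. *)
Notation borel_sphere n := (g_sigma_algebraType (@open (sphere n))).

Definition sphere_val n (x : sphere n) : 'rV[R]_n.+1 := set_val x.

Local Open Scope ereal_scope.

Definition tight_pframe n (p : nat) (mu : probability (borel_sphere n) R) : Prop :=
  exists2 A : R, (0 < A)%R & forall y : 'rV[R]_n.+1,
    \int[mu]_x (`|dotp (sphere_val x) y| ^+ p)%:E = (A * enorm y ^+ p)%:E.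

Definition frame_potential n (p : nat) (mu : probability (borel_sphere n) R) : \bar R :=
  \int[mu]_y \int[mu]_x (`|dotp (sphere_val x) (sphere_val y)| ^+ p)%:E.

End Defs.

Notation borel_sphere R n := (g_sigma_algebraType (@open (sphere R n))).

(* Main.v *)
Require Import Defs.
From HB Require Import structures.
From mathcomp Require Import all_boot all_order all_algebra.
From mathcomp Require Import all_classical all_reals all_analysis.
From mathcomp Require Import ring.
Import Order.TTheory GRing.Theory Num.Theory.
Import numFieldNormedType.Exports.
Local Open Scope classical_set_scope.
Local Open Scope ring_scope.

Set Implicit Arguments.
Unset Strict Implicit.

(** Write p = 2m and d for the dimension.  Expanding the power of the inner
    product over words w of length p in the d letters,
      <x,y>^p = sum_w x^w y^w,   where x^w is the product of the x_i, i in w,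
    turns the frame potential into the squared norm of the moment tensor
    T(w) = int x^w dmu: the double integral is sum_w T(w)^2
    ([frame_potential_moment]).  The bound is then the Cauchy-Schwarz
    inequality between T and one fixed tensor G that is proportional to the
    symmetric tensor of the form |x|^p.

    A convenient G is the moment tensor of the standard Gaussian vector,
    G(w) = prod_i E[g^(c_i)] with c_i the number of letters i in w.  With
    kappa = 1 * 3 * ... * (p-1) and rho = d (d+2) ... (d+p-2), integration by
    parts, E[g^(k+2)] = (k+1) E[g^k], yields by purely algebraic means
      sum_w G(w) x^w = kappa |x|^p   ([gauss_form]),
      sum_w G(w)^2   = kappa rho     ([gauss_norm]).
    Integrating the first identity over the sphere gives
    sum_w G(w) T(w) = kappa, whatever mu is ([gauss_moment_pairing]), so that
      sum_w T(w)^2 - kappa / rho = sum_w (T(w) - G(w) / rho)^2 >= 0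
    ([potential_gap]).

    Equality means T = G / rho, and then int |<x,y>|^p dmu(x) =
    sum_w T(w) y^w = (kappa / rho) |y|^p, i.e. mu is a tight frame.  Conversely,
    for a tight frame with constant A the symmetric tensors T and (A / kappa) G
    define the same form in y, hence coincide by polarization
    ([symmetric_form_eq0]); pairing with G gives A = kappa / rho, and the
    potential is kappa / rho. *)

(** * Sums over words *)

Section Words.
Variable I : finType.

Lemma big_tuple_cons (V : nmodType) N (F : seq I -> V) :
  \sum_(w : N.+1.-tuple I) F w = \sum_i \sum_(w : N.-tuple I) F (i :: w).
Proof.
rewrite pair_big /= (reindex (fun u : I * N.-tuple I => [tuple of u.1 :: u.2])) //.
exists (fun w : N.+1.-tuple I => (thead w, [tuple of behead w])).
  by case=> i w _ /=; rewrite theadE; congr pair; apply/val_inj.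
by move=> w _; rewrite [w in RHS]tuple_eta; apply/val_inj.
Qed.

Lemma big_tuple_nil (V : nmodType) (F : seq I -> V) :
  \sum_(w : 0.-tuple I) F w = F [::].
Proof. by rewrite (big_pred1 [tuple]) // => w; rewrite [w]tuple0 /= eqxx. Qed.

(** Tensors are functions on all finite words, so that one function carries a
    tensor of each order and contractions need no casts between lengths. *)
Definition symmetric_word (V : Type) (F : seq I -> V) :=
  forall s t, perm_eq s t -> F s = F t.

Lemma symmetric_word_cons (V : Type) (F : seq I -> V) i :
  symmetric_word F -> symmetric_word (fun w => F (i :: w)).
Proof. by move=> symF s t st; apply: symF; rewrite perm_cons. Qed.

Lemma symmetric_word_swap (V : Type) (F : seq I -> V) i j w :
  symmetric_word F -> F (i :: j :: w) = F (j :: i :: w).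
Proof. by apply; rewrite -[i :: _]/([:: i] ++ [:: j] ++ w) perm_catCA. Qed.

(** The left side sums F over words with a marked occurrence of i; by symmetry
    each of the N.+1 possible positions of the mark contributes as much as the
    first one.  The induction on N moves the mark past the first letter. *)
Lemma sum_count_mem (R : pzSemiRingType) N (F : seq I -> R) i :
    symmetric_word F ->
  \sum_(w : N.+1.-tuple I) (count_mem i w)%:R * F w =
  N.+1%:R * \sum_(w : N.-tuple I) F (i :: w).
Proof.
elim: N F => [|N IH] F symF;
  rewrite (big_tuple_cons _ (fun w => (count_mem i w)%:R * F w)).
  rewrite (big_tuple_nil (fun w => F (i :: w))) mul1r (bigD1 i) //=.
  rewrite (big_tuple_nil (fun w => ((i == i) + count_mem i w)%:R * F (i :: w))).
  rewrite /= eqxx mul1r.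
  rewrite big1 ?addr0 // => j /negPf ji.
  rewrite (big_tuple_nil (fun w => ((j == i) + count_mem i w)%:R * F (j :: w))).
  by rewrite /= ji mul0r.
under eq_bigr => j _.
  under eq_bigr => w _ do rewrite /= natrD mulrDl.
  rewrite big_split /= -big_distrr /=.
  rewrite (IH (fun w => F (j :: w))); last exact: symmetric_word_cons.
  under [X in _ + _ * X]eq_bigr => w _ do rewrite symmetric_word_swap //.
  over.
rewrite big_split /= -big_distrr /= -(@big_tuple_cons _ _ (fun w => F (i :: w))).
rewrite (bigD1 i) //= eqxx mul1r.
rewrite [X in _ + X + _]big1 => [|j /negPf ->]; last by rewrite mul0r.
rewrite addr0.
by rewrite -[in RHS]natr1 mulrDl mul1r addrC.
Qed.

Lemma sum_count_mem_all (w : seq I) : (\sum_i count_mem i w = size w)%N.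
Proof.
elim: w => [|j w IH]; first exact: big1.
rewrite big_split /= IH (bigD1 j) //= eqxx big1 // => i /negPf.
by rewrite eq_sym => ->.
Qed.

Lemma expr_sum (R : comPzSemiRingType) N (v : I -> R) :
  (\sum_i v i) ^+ N = \sum_(w : N.-tuple I) \prod_(i <- w) v i.
Proof.
elim: N => [|N IH].
  by rewrite expr0 (big_tuple_nil (fun w => \prod_(i <- w) v i)) big_nil.
rewrite exprS IH (big_tuple_cons _ (fun w => \prod_(i <- w) v i)) big_distrl /=.
apply: eq_bigr => i _; rewrite big_distrr; apply: eq_bigr => w _.
by rewrite big_cons.
Qed.

End Words.

(** * The Gaussian moment tensor *)

Section GaussTensor.
Variable I : finType.

(** The k-th moment of the standard normal law. *)
Definition gauss_moment k : nat :=
  (if odd k then 0 else \prod_(1 <= j < k | odd j) j)%N.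

Lemma gauss_momentSS k : gauss_moment k.+2 = (k.+1 * gauss_moment k)%N.
Proof.
rewrite /gauss_moment /= negbK; case: ifP => [|ek]; first by rewrite muln0.
case: k ek => [|k] ek; first by rewrite big_mkcond big_nat1 big_geq.
rewrite big_mkcond [in RHS]big_mkcond /= !(big_nat_recr k.+1, big_nat_recr k.+2) //=.
by move: ek => /= /negbFE ->; rewrite muln1 mulnC.
Qed.

Lemma gauss_moment_even m :
  gauss_moment m.*2 = (\prod_(1 <= j < m.*2 | odd j) j)%N.
Proof. by rewrite /gauss_moment odd_double. Qed.

Definition gauss_tensor (w : seq I) : nat :=
  (\prod_i gauss_moment (count_mem i w))%N.

Lemma gauss_tensor_symmetric : symmetric_word gauss_tensor.
Proof. by move=> s t /permP st; apply: eq_bigr => i _; rewrite st. Qed.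

Lemma gauss_tensor_nil : gauss_tensor [::] = 1%N.
Proof. by apply: big1 => i _; rewrite /gauss_moment /= big_geq. Qed.

(** Wick's rule: the new letter i is paired with each i already in w. *)
Lemma gauss_tensor_cons i w :
  gauss_tensor (i :: w) = (count_mem i w * gauss_tensor (rem i w))%N.
Proof.
rewrite /gauss_tensor (bigD1 i) //= eqxx add1n.
rewrite (bigD1 i (F := fun j => gauss_moment (count_mem j (rem i w)))) //=.
rewrite mulnA; congr (_ * _)%N.
  rewrite count_rem /= eqxx andbT -has_pred1 has_count.
  by case: (count_mem i w) => //= k; rewrite subn1 gauss_momentSS.
apply: eq_bigr => j ji; rewrite count_rem /= eq_sym (negPf ji) andbF subn0.
by rewrite add0n.
Qed.

Lemma gauss_tensor_cons2 i w :
  gauss_tensor (i :: i :: w) = ((count_mem i w).+1 * gauss_tensor w)%N.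
Proof. by rewrite gauss_tensor_cons /= eqxx. Qed.

(** Contracting two indices: each i contributes c_i + 1 copies of G(w), where
    c_i is the multiplicity of i in w. *)
Lemma gauss_tensor_trace w :
  (\sum_i gauss_tensor (i :: i :: w) = (#|I| + size w) * gauss_tensor w)%N.
Proof.
under eq_bigr => i _ do rewrite gauss_tensor_cons2.
rewrite -big_distrl /= -sum_count_mem_all -sum1_card -big_split.
by congr (_ * _)%N; apply: eq_bigr => i _; rewrite add1n.
Qed.

Variable R : comPzRingType.

(** Gaussian integration by parts in tensor form.  Wick's rule on the first
    letter chooses a partner for it; by [sum_count_mem] the N.+1 choices
    contribute equally, and each contracts two slots of F.  This one step drives
    the evaluation of the form and of the norm of G. *)
Lemma gauss_contract N (F : seq I -> R) : symmetric_word F ->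
  \sum_(w : N.+2.-tuple I) (gauss_tensor w)%:R * F w =
  N.+1%:R * \sum_(w : N.-tuple I) (gauss_tensor w)%:R * \sum_i F (i :: i :: w).
Proof.
move=> symF.
rewrite (big_tuple_cons _ (fun w => (gauss_tensor w)%:R * F w)).
under eq_bigr => i _.
  under eq_bigr => w _ do rewrite gauss_tensor_cons natrM -mulrA.
  rewrite (sum_count_mem _
    (F := fun w => (gauss_tensor (rem i w))%:R * F (i :: w))); last first.
    move=> s t st; congr (_%:R * _); last by apply: symF; rewrite perm_cons.
    apply: gauss_tensor_symmetric; apply/permP => a.
    by rewrite !count_rem (perm_mem st) (permP st).
  under [X in _ * X]eq_bigr => w _ do rewrite /= eqxx.
  over.
rewrite -big_distrr /= exchange_big /=; congr (_ * _).
by apply: eq_bigr => w _; rewrite big_distrr.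
Qed.

Lemma gauss_form m (x : I -> R) :
  \sum_(w : (m.*2).-tuple I) (gauss_tensor w)%:R * \prod_(i <- w) x i =
  (gauss_moment m.*2)%:R * (\sum_i x i ^+ 2) ^+ m.
Proof.
elim: m => [|m IH].
  rewrite double0.
  rewrite (big_tuple_nil (fun w => (gauss_tensor w)%:R * \prod_(i <- w) x i)).
  by rewrite gauss_tensor_nil big_nil /gauss_moment /= big_geq.
rewrite doubleS (gauss_contract _ (F := fun w => \prod_(i <- w) x i)); last first.
  by move=> s t st; exact: perm_big.
under eq_bigr => w _.
  under [X in _ * X]eq_bigr => i _ do rewrite !big_cons mulrA -expr2.
  rewrite -big_distrl /= mulrCA.
  over.
by rewrite -big_distrr /= IH gauss_momentSS natrM exprS; ring.
Qed.

(** Contracting G itself gives back (d + N) G by [gauss_tensor_trace]; these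
    factors build up the product d (d+2) ... (d+2m-2). *)
Lemma gauss_norm m :
  \sum_(w : (m.*2).-tuple I) (gauss_tensor w)%:R ^+ 2 =
  (gauss_moment m.*2)%:R * \prod_(0 <= j < m) (#|I| + 2 * j)%:R :> R.
Proof.
elim: m => [|m IH].
  rewrite double0 (big_tuple_nil (fun w => (gauss_tensor w)%:R ^+ 2)).
  by rewrite gauss_tensor_nil big_geq // /gauss_moment /= big_geq // expr1n mulr1.
rewrite doubleS; under [LHS]eq_bigr => w _ do rewrite expr2.
rewrite (gauss_contract _ (F := fun w => (gauss_tensor w)%:R)); last first.
  by move=> s t st; congr _%:R; exact: gauss_tensor_symmetric.
under [in LHS]eq_bigr => w _.
  rewrite -natr_sum gauss_tensor_trace size_tuple natrM mulrCA -expr2.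
  over.
rewrite -big_distrr /= IH gauss_momentSS natrM big_nat_recr //= mul2n.
by ring.
Qed.

End GaussTensor.

(** * Polarization *)

Section Polarization.
Variables (I : finType).

(** By symmetry of D the derivative may be taken in the first letter only. *)
Lemma deriv_form (R : comNzRingType) N (D : seq I -> R) (q : I -> {poly R}) :
    symmetric_word D ->
  (\sum_(w : N.+1.-tuple I) D w *: \prod_(i <- w) q i)^`() =
  N.+1%:R *:
    \sum_i (q i)^`() *
      \sum_(w : N.-tuple I) D (i :: w) *: \prod_(i <- w) q i.
Proof.
elim: N D => [|N IH] D symD;
  rewrite (big_tuple_cons _ (fun w => D w *: \prod_(i <- w) q i)).
  rewrite scale1r raddf_sum /=; apply: eq_bigr => i _.
  rewrite (big_tuple_nil (fun w => D (i :: w) *: \prod_(i <- i :: w) q i)).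
  rewrite (big_tuple_nil (fun w => D (i :: w) *: \prod_(i <- w) q i)).
  by rewrite big_cons !big_nil mulr1 derivZ -scalerAr mulr1.
rewrite raddf_sum /=.
under eq_bigr => i _.
  under eq_bigr => w _ do rewrite big_cons scalerAr.
  rewrite -big_distrr /= derivM (IH (fun w => D (i :: w))); last first.
    exact: symmetric_word_cons.
  rewrite -scalerAr.
  over.
rewrite big_split /= -scaler_sumr addrC -[N.+2%:R]natr1 [in RHS]scalerDl scale1r.
congr (_ *: _ + _).
under [LHS]eq_bigr => i _ do rewrite mulr_sumr.
rewrite [LHS]exchange_big /=; apply: eq_bigr => j _.
rewrite (big_tuple_cons _ (fun w => D (j :: w) *: \prod_(i <- w) q i)).
rewrite big_distrr /=.
apply: eq_bigr => i _; rewrite mulrCA; congr (_ * _).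
rewrite big_distrr /=; apply: eq_bigr => w _.
by rewrite big_cons -scalerAr symmetric_word_swap.
Qed.

Lemma poly_eq0_fun (R : numDomainType) (p : {poly R}) :
  (forall t, p.[t] = 0) -> p = 0.
Proof.
move=> p0; apply: (@roots_geq_poly_eq0 _ p [seq k%:R | k <- iota 0 (size p)]).
- by apply/allP => x _; rewrite /root p0.
- by rewrite map_inj_uniq ?iota_uniq // => a b /eqP; rewrite eqr_nat => /eqP.
- by rewrite size_map size_iota.
Qed.

(** If the form of D vanishes identically then so does its partial derivative
    in the i-th variable, which is N.+1 times the form of D (i :: _), of lower
    degree. *)
Lemma symmetric_form_eq0 (R : numDomainType) N (D : seq I -> R) :
    symmetric_word D ->
    (forall y : I -> R, \sum_(w : N.-tuple I) D w * \prod_(i <- w) y i = 0) ->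
  forall w : N.-tuple I, D w = 0.
Proof.
elim: N D => [|N IH] D symD D0 w.
  have := D0 (fun=> 0).
  rewrite (big_tuple_nil (fun w => D w * \prod_(i <- w) 0)) big_nil mulr1.
  by rewrite [w]tuple0.
case/tupleP: w => i w /=; apply: (IH (fun w => D (i :: w))) => [|y].
  exact: symmetric_word_cons.
(* The line through y in the i-th direction, with parameter 'X. *)
pose q j : {poly R} := (y j)%:P + (j == i)%:R *: 'X.
have qE0 : \sum_(w : N.+1.-tuple I) D w *: \prod_(j <- w) q j = 0.
  apply: poly_eq0_fun => t; rewrite horner_sum.
  rewrite -[RHS](D0 (fun j => (q j).[t])); apply: eq_bigr => u _.
  by rewrite hornerZ horner_prod.
have /(congr1 (fun p => p.[0])) := deriv_form N q symD.
rewrite qE0 deriv0 horner0 hornerZ horner_sum => /esym/eqP.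
rewrite mulf_eq0 pnatr_eq0 /= => /eqP sum0; rewrite -[RHS]sum0 {sum0}.
rewrite (bigD1 i) //= [X in _ = _ + X]big1 => [|j ji]; last first.
  by rewrite /q (negPf ji) scale0r addr0 derivC mul0r horner0.
rewrite addr0 {1}/q derivD derivC derivZ derivX eqxx scale1r add0r mul1r.
rewrite horner_sum.
apply: eq_bigr => u _; rewrite hornerZ horner_prod; congr (_ * _).
by apply: eq_bigr => j _; rewrite hornerD hornerC hornerZ hornerX mulr0 addr0.
Qed.

End Polarization.

(** * Moments of a probability on the sphere *)

Section Moments.
Variables (R : realType) (n : nat).
Implicit Types (x : borel_sphere R n) (y : 'rV[R]_n.+1) (w : seq 'I_n.+1).

Lemma measurable_coord i : measurable_fun setT (fun x => sphere_val x 0 i : R).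
Proof.
apply: (measurability _ (measurable_realfun.RGenOpens.measurableE R)).
move=> _ [_ [a [b ->] <-]]; rewrite setTI; apply: sub_sigma_algebra.
have cont : continuous (fun x : sphere R n => sphere_val x 0 i).
  move=> z; apply: (@continuous_comp _ _ _ (@sphere_val R n) (fun y => y 0 i)).
    exact: initial_continuous.
  exact: coord_continuous.
by move/continuousP: cont; apply; exact: interval_open.
Qed.

Lemma dotp_sphere x : dotp (sphere_val x) (sphere_val x) = 1.
Proof.
have := set_valP x; rewrite /usphere /= /enorm => /(congr1 (fun t => t ^+ 2)).
rewrite expr1n sqr_sqrtr //; apply: sumr_ge0 => i _; exact: sqr_ge0.
Qed.

Lemma coord_le1 x i : `|sphere_val x 0 i| <= 1.
Proof.
rewrite -(@expr_le1 _ 2) // real_normK ?num_real // -(dotp_sphere x) /dotp.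
rewrite (bigD1 i) //= expr2 lerDl; apply: sumr_ge0 => j _; exact: sqr_ge0.
Qed.

Definition monomial w y : R := \prod_(i <- w) y 0 i.

Lemma dotp_pow N (x y : 'rV[R]_n.+1) : dotp x y ^+ N =
  \sum_(w : N.-tuple 'I_n.+1) monomial w x * monomial w y.
Proof.
by rewrite /dotp expr_sum; apply: eq_bigr => w _; rewrite -big_split.
Qed.

Variable mu : probability (borel_sphere R n) R.

Lemma integrable_monomial w :
  mu.-integrable setT (fun x => (monomial w (sphere_val x))%:E).
Proof.
apply: measurable_bounded_integrable => //.
- have mu_fin : (mu setT < +oo)%E by rewrite (@probability_setT _ _ _ mu) ltry.
  exact: mu_fin.
- by apply: measurable_prod => i _; exact: measurable_coord.
- exists 1; split; first exact: num_real.
  move=> M /ltW M1 x _ /=; apply: le_trans M1; rewrite /monomial normr_prod.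
  by apply: prodr_ile1 => i _; rewrite normr_ge0 coord_le1.
Qed.

Definition moment w : R := fine (\int[mu]_x (monomial w (sphere_val x))%:E).

Lemma moment_symmetric : symmetric_word moment.
Proof.
move=> s t st; congr fine; apply: eq_integral => x _; congr EFin.
exact: perm_big.
Qed.

Lemma integral_form N (c : seq 'I_n.+1 -> R) :
  (\int[mu]_x (\sum_(w : N.-tuple 'I_n.+1) c w * monomial w (sphere_val x))%:E =
   (\sum_(w : N.-tuple 'I_n.+1) c w * moment w)%:E)%E.
Proof.
under eq_integral => x _ do rewrite -sumEFin.
rewrite integral_sum //; last first.
  move=> w; under eq_fun do rewrite EFinM.
  by apply: integrableZl => //; exact: integrable_monomial.
rewrite -sumEFin; apply: eq_bigr => w _.
under eq_integral => x _ do rewrite EFinM.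
rewrite integralZl //; last exact: integrable_monomial.
rewrite EFinM fineK //; apply: integrable_fin_num => //.
exact: integrable_monomial.
Qed.

Lemma integral_dotp_pow m y :
  (\int[mu]_x (`|dotp (sphere_val x) y| ^+ m.*2)%:E =
   (\sum_(w : (m.*2).-tuple 'I_n.+1) monomial w y * moment w)%:E)%E.
Proof.
rewrite -(integral_form _ (fun w => monomial w y)); apply: eq_integral => x _.
congr EFin.
rewrite -normrX ger0_norm; last by rewrite exprn_even_ge0 ?odd_double.
by rewrite dotp_pow; apply: eq_bigr => w _; rewrite mulrC.
Qed.

(** The inner integral is a form in y with coefficients T(w), and integrating
    this form replaces each monomial by its moment T(w) again. *)
Lemma frame_potential_moment m :
  (frame_potential m.*2 mu =
   (\sum_(w : (m.*2).-tuple 'I_n.+1) moment w ^+ 2)%:E)%E.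
Proof.
rewrite /frame_potential; under eq_integral => y _.
  rewrite integral_dotp_pow; under eq_bigr => w _ do rewrite mulrC.
  over.
by rewrite integral_form.
Qed.

Lemma gauss_form_row m y :
  \sum_(w : (m.*2).-tuple 'I_n.+1) (gauss_tensor w)%:R * monomial w y =
  (gauss_moment m.*2)%:R * enorm y ^+ m.*2.
Proof.
rewrite gauss_form -mul2n exprM sqr_sqrtr; last first.
  by apply: sumr_ge0 => i _; exact: sqr_ge0.
by congr (_ * _ ^+ m).
Qed.

(** On the sphere the form of G is the constant kappa, which is why the pairing
    of T with G is the same for all probabilities. *)
Lemma gauss_moment_pairing m :
  \sum_(w : (m.*2).-tuple 'I_n.+1) (gauss_tensor w)%:R * moment w =
  (gauss_moment m.*2)%:R.
Proof.
apply: EFin_inj; rewrite -(integral_form _ (fun w => (gauss_tensor w)%:R)).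
transitivity (\int[mu]_x (cst (gauss_moment m.*2)%:R%:E x))%E.
  apply: eq_integral => x _; rewrite gauss_form_row.
  by have := set_valP x; rewrite /usphere /= => ->; rewrite expr1n mulr1.
rewrite integral_cst //=.
transitivity ((gauss_moment m.*2)%:R%:E * mu setT)%E; first by [].
by rewrite (@probability_setT _ _ _ mu) mule1.
Qed.

End Moments.

(** * The potential gap and its vanishing *)

Section Gap.
Variables (R : realType) (n m : nat) (mu : probability (borel_sphere R n) R).
Let kappa : R := (gauss_moment m.*2)%:R.
Let rho : R := \prod_(0 <= j < m) (n.+1 + 2 * j)%:R.

Lemma gauss_moment_even_gt0 : 0 < kappa.
Proof.
rewrite /kappa gauss_moment_even ltr0n big_mkcond /=.
by apply: prodn_gt0 => -[|k] //=; case: ifP.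
Qed.

Lemma rising_prod_gt0 : 0 < rho.
Proof. by apply: prodr_gt0 => j _; rewrite ltr0n. Qed.

Lemma gauss_norm_row :
  \sum_(w : (m.*2).-tuple 'I_n.+1) (gauss_tensor w)%:R ^+ 2 = kappa * rho.
Proof. by rewrite gauss_norm card_ord. Qed.

(** Expanding the square, the cross term is known from the pairing of T with G
    and the last term from the norm of G. *)
Lemma potential_gap :
  \sum_(w : (m.*2).-tuple 'I_n.+1) moment mu w ^+ 2 - kappa / rho =
  \sum_(w : (m.*2).-tuple 'I_n.+1)
    (moment mu w - rho^-1 * (gauss_tensor w)%:R) ^+ 2.
Proof.
have rho_neq0 := lt0r_neq0 rising_prod_gt0.
under [RHS]eq_bigr => w _.
  have -> : (moment mu w - rho^-1 * (gauss_tensor w)%:R) ^+ 2 =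
    moment mu w ^+ 2 + (rho^-1 ^+ 2 * (gauss_tensor w)%:R ^+ 2 -
       2 * rho^-1 * ((gauss_tensor w)%:R * moment mu w)) by ring.
  over.
rewrite !big_split /= sumrN -!big_distrr /= gauss_norm_row.
rewrite gauss_moment_pairing -/kappa.
by congr (_ + _); field.
Qed.

Lemma tight_of_moment :
  (forall w : (m.*2).-tuple 'I_n.+1,
    moment mu w = rho^-1 * (gauss_tensor w)%:R) ->
  tight_pframe m.*2 mu.
Proof.
move=> momE; exists (kappa / rho); first apply: divr_gt0.
- exact: gauss_moment_even_gt0.
- exact: rising_prod_gt0.
move=> y; rewrite integral_dotp_pow; congr EFin.
under eq_bigr => w _ do rewrite momE mulrCA [monomial _ _ * _]mulrC.
by rewrite -big_distrr /= gauss_form_row mulrA [rho^-1 * _]mulrC.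
Qed.

(** Tightness says that T and (A / kappa) G have the same form; both tensors
    are symmetric, so polarization applies to their difference. *)
Lemma moment_of_tight A :
  (forall y : 'rV[R]_n.+1,
    \int[mu]_x (`|dotp (sphere_val x) y| ^+ m.*2)%:E = (A * enorm y ^+ m.*2)%:E)%E ->
  forall w : (m.*2).-tuple 'I_n.+1,
    moment mu w = A / kappa * (gauss_tensor w)%:R.
Proof.
move=> tightA w; apply/eqP; rewrite -subr_eq0; apply/eqP.
pose D u := moment mu u - A / kappa * (gauss_tensor u)%:R.
apply: (@symmetric_form_eq0 _ _ _ D _ _ w) => [s t st|y].
  by rewrite /D (moment_symmetric mu st) (gauss_tensor_symmetric st).
have := tightA (\row_i y i).
rewrite integral_dotp_pow => -[].
have kappa_neq0 := lt0r_neq0 gauss_moment_even_gt0.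
rewrite -[A in RHS](divfK kappa_neq0) -[RHS]mulrA -[kappa * _]gauss_form_row.
rewrite big_distrr /= => /eqP.
rewrite -subr_eq0 -sumrB => /eqP sum0; rewrite -[RHS]sum0; apply: eq_bigr => u _.
have -> : monomial u (\row_i y i) = \prod_(i <- u) y i.
  by apply: eq_bigr => i _; rewrite mxE.
by rewrite /D; ring.
Qed.

(** Pairing the hypothesis with G gives kappa = (A / kappa) kappa rho, which
    determines A. *)
Lemma potential_of_tight A :
  (forall w : (m.*2).-tuple 'I_n.+1,
    moment mu w = A / kappa * (gauss_tensor w)%:R) ->
  \sum_(w : (m.*2).-tuple 'I_n.+1) moment mu w ^+ 2 = kappa / rho.
Proof.
move=> momE; have kappa_neq0 := lt0r_neq0 gauss_moment_even_gt0.
have rho_neq0 := lt0r_neq0 rising_prod_gt0.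
have := gauss_moment_pairing mu m.
under eq_bigr => w _ do rewrite momE mulrCA -expr2.
rewrite -big_distrr /= gauss_norm_row -/kappa => A_rho.
have {}A_rho : A * rho = kappa by rewrite -[RHS]A_rho; field.
under eq_bigr => w _ do rewrite momE exprMn.
rewrite -big_distrr /= gauss_norm_row -A_rho; field.
by rewrite rho_neq0; apply: contraNneq kappa_neq0 => A0; rewrite -A_rho A0 mul0r.
Qed.

End Gap.

Unset Implicit Arguments.
Set Strict Implicit.
Local Open Scope ereal_scope.

Theorem theorem4p10 (R : realType) (n p : nat) (hp0 : (0 < p)%N)
    (hp : ~~ odd p) (mu : probability (borel_sphere R n) R) :
  let d := n.+1 in
  let bound : R :=
    ((\prod_(1 <= k < p | odd k) k%:R) / \prod_(0 <= j < p./2) (d + 2 * j)%:R)%R in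
  bound%:E <= frame_potential p mu /\
  (frame_potential p mu = bound%:E <-> tight_pframe p mu).
Proof.
(* With p = 2m the odd product becomes the even Gaussian moment. *)
rewrite -(even_halfK hp) -natr_prod doubleK -gauss_moment_even /=.
move: p./2 => m {p hp0 hp}; rewrite frame_potential_moment.
have gap := potential_gap m mu; split.
  rewrite lee_fin -subr_ge0 gap; apply: sumr_ge0 => w _; exact: sqr_ge0.
split=> [[] /eqP | [A _ tightA]]; last first.
  by congr EFin; apply: potential_of_tight (moment_of_tight tightA).
rewrite -subr_eq0 gap psumr_eq0 => [/allP sq0|w _]; last exact: sqr_ge0.
apply: tight_of_moment => w; apply/eqP; rewrite -subr_eq0 -sqrf_eq0.
by apply: sq0; exact: mem_index_enum.
Qed.
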